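(* Let $D$ be a digraph. (i) If an end of $D$ contains $n$ pairwise disjoint rays for all $n\in\mathbb N$, then it contains infinitely many pairwise disjoint rays. (ii) If an end of $D$ contains $n$ pairwise disjoint anti-rays for all $n\in\mathbb N$, then it contains infinitely many pairwise disjoint anti-rays.
   Context: A dipath is a directed path. For vertex sets $A,B$, an $A$--$B$ dipath is a dipath that starts in $A$, ends in $B$ and is internally disjoint from $A\cup B$ (for subgraphs take their vertex sets). A ray is a weakly connected digraph in which each vertex has in- and out-degree $1$ except one vertex (its starting vertex) which has in-degree $0$ and out-degree $1$; an anti-ray is the same with in- and out-degree interchanged. Rays and anti-rays in $D$ are subdigraphs of $D$. Disjoint means vertex-disjoint. For rays or anti-rays $Q,R$ of $D$, write $Q\le R$ if there are infinitely many pairwise disjoint $Q$--$R$ dipaths in $D$, and $Q\sim R$ if $Q\le R$ and $R\le Q$. This $\sim$ is an equivalence relation on the set of rays and anti-rays of $D$; its classes are the ends of $D$. *)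

(* Defs.v *)
From Stdlib Require Import Relations.
From mathcomp Require Import all_boot boolp classical_sets functions cardinality.

Set Implicit Arguments.
Unset Strict Implicit.
Unset Printing Implicit Defensive.

Local Open Scope classical_set_scope.
Local Open Scope card_scope.

(* Digraphs of arbitrary cardinality, without parallel arcs; loops are
   permitted (no ray, anti-ray or dipath can use one). *)
Record digraph (V : Type) := Digraph {
  vset : set V;
  arcs : set (V * V);
  arcs_ends : forall u v, arcs (u, v) -> vset u /\ vset v
}.

Definition subdigraph (V : Type) (H D : digraph V) : Prop :=
  vset H `<=` vset D /\ arcs H `<=` arcs D.

Definition indegree_is (V : Type) (H : digraph V) (v : V) (k : nat) : Prop :=
  [set u | arcs H (u, v)] #= `I_k.

Definition outdegree_is (V : Type) (H : digraph V) (v : V) (k : nat) : Prop :=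
  [set w | arcs H (v, w)] #= `I_k.

Definition weakly_connected (V : Type) (H : digraph V) : Prop :=
  forall u v, vset H u -> vset H v ->
    clos_refl_sym_trans V (fun x y => arcs H (x, y)) u v.

Definition is_ray (V : Type) (H : digraph V) : Prop :=
  weakly_connected H /\
  exists2 r, vset H r &
    [/\ indegree_is H r 0, outdegree_is H r 1 &
        forall v, vset H v -> v <> r ->
          indegree_is H v 1 /\ outdegree_is H v 1].

Definition is_antiray (V : Type) (H : digraph V) : Prop :=
  weakly_connected H /\
  exists2 r, vset H r &
    [/\ indegree_is H r 1, outdegree_is H r 0 &
        forall v, vset H v -> v <> r ->
          indegree_is H v 1 /\ outdegree_is H v 1].

Definition rays_and_antirays (V : Type) (D : digraph V) : set (digraph V) :=
  [set H | subdigraph H D /\ (is_ray H \/ is_antiray H)].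

(* A dipath is given by its nonempty sequence of vertices; a single vertex is
   a trivial dipath. *)
Definition is_dipath (V : eqType) (D : digraph V) (x : V) (p : seq V) : Prop :=
  [/\ vset D x, path (fun u v => (u, v) \in arcs D) x p & uniq (x :: p)].

(* [behead (belast x p)] lists the internal vertices of [x :: p]. *)
Definition is_dipath_between (V : eqType) (D : digraph V) (A B : set V)
    (s : seq V) : Prop :=
  exists x p, s = x :: p /\
    [/\ is_dipath D x p, A x, B (last x p) &
        forall y, y \in behead (belast x p) -> ~ (A `|` B) y].

Definition end_le (V : eqType) (D Q R : digraph V) : Prop :=
  exists S : set (seq V),
    [/\ S `<=` is_dipath_between D (vset Q) (vset R),
        trivIset S (fun s => [set` s]) & infinite_set S].

Definition end_equiv (V : eqType) (D Q R : digraph V) : Prop :=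
  end_le D Q R /\ end_le D R Q.

Definition is_end (V : eqType) (D : digraph V) (w : set (digraph V)) : Prop :=
  exists2 R, rays_and_antirays D R &
    w = [set Q | rays_and_antirays D Q /\ end_equiv D Q R].

Definition has_n_disjoint (V : Type) (F : set (digraph V)) (n : nat) : Prop :=
  exists S : set (digraph V),
    [/\ S `<=` F, trivIset S (@vset V) & S #= `I_n].

Definition has_infinitely_many_disjoint (V : Type) (F : set (digraph V)) :
    Prop :=
  exists S : set (digraph V),
    [/\ S `<=` F, trivIset S (@vset V) & infinite_set S].

(* Main.v *)
(* Halin's argument, with Gale-Shapley matching in place of Menger's theorem. Fix
   a ray or anti-ray R0 of the end. Given n disjoint rays R_i of the end with
   prescribed initial segments, and many disjoint rays S_j of the end avoiding
   these segments, let R_i propose to the S_j in the order in which it meets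
   them, and let S_j prefer proposals made late on S_j. In a stable matching, the
   rays obtained by following R_i and then its partner S_j are disjoint, and they
   are disjoint from every unmatched S_j; so there are n + 1 disjoint rays of the
   end, n of which extend the prescribed segments. In the limit one gets infinitely
   many disjoint rays, and they belong to the end if each step also lengthens the
   segments so as to contain an end of new dipaths to and from R0. The statement
   on anti-rays follows by reversing all arcs. *)
From Stdlib Require Import Relations.
Require Import Defs.
From mathcomp Require Import all_boot boolp classical_sets functions cardinality.
From mathcomp Require Import zify.

Set Implicit Arguments.
Unset Strict Implicit.
Unset Printing Implicit Defensive.

Local Open Scope classical_set_scope.

(** * Stable matching of two disjoint families of rays, and rerouting *)

Definition jointly_injective (I V : Type) (r : I -> nat -> V) : Prop :=
  forall i i' k k', r i k = r i' k' -> i = i' /\ k = k'.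

(** Meant for [f t = g a]: the switching vertex is read from [f], and [g] takes over at position
    [a.+1]. *)
Definition splice (V : Type) (f : nat -> V) (t : nat) (g : nat -> V)
    (a k : nat) : V :=
  if (k <= t)%N then f k else g (a + (k - t)).

Section StableRerouting.
Variables (V : Type) (I J : finType) (R : I -> nat -> V) (S : J -> nat -> V).
Hypotheses (Rinj : jointly_injective R) (Sinj : jointly_injective S).

Definition meets (i : I) (j : J) : Prop := exists s b, R i s = S j b.

(* The Gale-Shapley invariant: ray [i] proposes to the rays of [S] in the order
   in which it meets them and currently stands at [t i]; a ray of [S] prefers
   late vertices, and every crossing already passed was rejected in favour of
   a later one. *)
Definition settled (A : {set I}) (B : {set J}) (t : I -> nat) : Prop :=
  forall i s j b, i \in A -> j \in B -> s < t i -> R i s = S j b ->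
    exists i' b', [/\ i' \in A, R i' (t i') = S j b' & b < b'].

(** The only newly passed crossing is the one at [t i], covered by the hypothesis. Where [i] itself
    was the witness for an older crossing, the hypothesis provides a replacement still later on the
    same ray of [S]. *)
Lemma settled_advance (A : {set I}) (B : {set J}) (t : I -> nat) (i : I) :
  settled A B t ->
  (forall j b, j \in B -> R i (t i) = S j b ->
    exists i' b', [/\ i' \in A, i' != i, R i' (t i') = S j b' & b < b']) ->
  settled A B (fun x => if x == i then (t i).+1 else t x).
Proof.
move=> tP iP i0 s j b i0A jB s_lt RSb.
have [s_ge|s_lt'] := leqP (t i0) s.
  have i0i : i0 = i by apply/eqP; case: eqP s_lt => // _; lia.
  have st : s = t i by move: s_lt s_ge; rewrite i0i eqxx; lia.
  subst i0 s.
  have [i' [b' [i'A i'i RSb' bb']]] := iP _ _ jB RSb.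
  by exists i', b'; rewrite (negPf i'i).
have [i1 [b1 [i1A RSb1 bb1]]] := tP _ _ _ _ i0A jB s_lt' RSb.
have [i1i|i1i] := eqVneq i1 i; last by exists i1, b1; rewrite (negPf i1i).
rewrite i1i in RSb1.
have [i' [b' [i'A i'i RSb' bb']]] := iP _ _ jB RSb1.
by exists i', b'; rewrite (negPf i'i); split=> //; lia.
Qed.

(** Among the states satisfying the invariant, take one of maximal total progress. No ray of [A] can
    then move on, so each stands on a ray of [B] on which no other stands later. *)
Lemma stable_matching (A : {set I}) (B : {set J}) (j0 : J) :
  (forall i, i \in A -> #|A| < #|[set j in B | `[< meets i j >]]|) ->
  exists (t : I -> nat) (m : I -> J) (a : I -> nat),
    [/\ settled A B t,
        forall i, i \in A -> m i \in B /\ R i (t i) = S (m i) (a i) &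
        {in A &, injective m}].
Proof.
move=> rich.
have /choice[h hP] : forall ij : I * J, exists s : nat,
    meets ij.1 ij.2 -> exists b, R ij.1 s = S ij.2 b.
  move=> [i j]; case: (pselect (meets i j)) => [[s]|]; first by exists s.
  by exists 0.
pose Z := (\max_ij h ij).+1.
(* A ray at [Z] or beyond has passed a crossing with every ray of [B] it meets. By the invariant
   some ray of [A] stands on each of these, and none stands on two, so there are at most [#|A|] of
   them, against [rich]. *)
have bounded t i : settled A B t -> i \in A -> t i < Z.
  move=> tP iA; rewrite ltnNge; apply/negP => Zt.
  have /choice[g gP] : forall j, exists i',
      j \in [set j in B | `[< meets i j >]] ->
      i' \in A /\ exists b, R i' (t i') = S j b.
    move=> j; case: (boolP (j \in _)) => [|_]; last by exists i.
    rewrite inE => /andP[jB /asboolP ij].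
    have [b RSb] := hP (i, j) ij.
    have [] := tP i (h (i, j)) j b iA jB _ RSb.
      by apply: leq_trans Zt; rewrite ltnS; exact: leq_bigmax.
    by move=> i' [b' [i'A RSb' _]]; exists i' => _; split=> //; exists b'.
  have := rich i iA; rewrite ltnNge => /negP; apply.
  rewrite -(@card_in_imset _ _ g); last first.
    move=> j j' /gP[_ [b gb]] /gP[_ [b' gb']] gg.
    by have [] := @Sinj j j' b b'; rewrite -?gb -?gb' ?gg.
  by apply/subset_leq_card/fintype.subsetP => _ /imsetP[j /gP[? _] ->].
pose total k := `[< exists t, settled A B t /\ \sum_(i in A) t i = k >].
have exk : exists k, total k.
  by exists (\sum_(i in A) 0); apply/asboolP; exists (fun=> 0); split.
have lek k : total k -> k <= \sum_(i in A) Z.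
  by move=> /asboolP[t [tP <-]]; apply: leq_sum => i iA; exact/ltnW/bounded.
have [k /asboolP[t [tP tk]] kmax] := ex_maxnP exk lek.
have stuck i : i \in A -> exists j b, [/\ j \in B, R i (t i) = S j b &
    forall i' b', i' \in A -> i' != i -> R i' (t i') = S j b' -> b' <= b].
  move=> iA; apply: contrapT => no.
  have : settled A B (fun x => if x == i then (t i).+1 else t x).
    apply: settled_advance => // j b jB RSb; apply: contrapT => no'.
    apply: no; exists j, b; split=> // i' b' i'A i'i RSb'.
    by rewrite leqNgt; apply/negP => bb'; apply: no'; exists i', b'.
  set t' := (X in settled _ _ X) => t'P.
  have : total (\sum_(i in A) t' i) by apply/asboolP; exists t'.
  move=> /kmax; rewrite -tk (bigD1 i iA) [X in _ <= X](bigD1 i iA) /= /t' eqxx.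
  rewrite (@eq_bigr _ _ _ _ _ _ _ t); first by rewrite addSn ltnn.
  by move=> x /andP[_ /negPf ->].
have /choice[m mP] : forall i, exists jb, i \in A ->
    [/\ jb.1 \in B, R i (t i) = S jb.1 jb.2 & forall i' b',
      i' \in A -> i' != i -> R i' (t i') = S jb.1 b' -> b' <= jb.2].
  move=> i; case: (boolP (i \in A)) => [/stuck[j [b]]|_].
    by exists (j, b).
  by exists (j0, 0).
exists t, (fun i => (m i).1), (fun i => (m i).2); split=> //.
  by move=> i /mP[].
(* Of two rays sharing a partner, each is at least as late as the other, so both stand at one
   vertex, against disjointness of [R]. *)
move=> i i' iA i'A mm; apply: contrapT => /eqP i'i.
have [_ RSi max] := mP i iA; have [_ RSi' max'] := mP i' i'A.
have le1 : (m i').2 <= (m i).2.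
  by apply: (max i') => //; [rewrite eq_sym | rewrite RSi' mm].
have le2 : (m i).2 <= (m i').2 by apply: (max' i) => //; rewrite RSi mm.
have e : (m i).2 = (m i').2 by lia.
have [ii _] : i = i' /\ t i = t i' by apply: Rinj; rewrite RSi RSi' mm e.
by rewrite ii eqxx in i'i.
Qed.

(** The square bounds the number of rays of [S] given up, the linear term the number of partners;
    one more ray is left for [j0]. *)
Lemma reroute : #|I| * #|I| + #|I| < #|J| ->
  exists (T : I -> nat -> V) (j0 : J),
    [/\ jointly_injective T,
        forall i k k', T i k <> S j0 k' &
        forall i, T i = R i \/
          exists t j a, R i t = S j a /\ T i = splice (R i) t (S j) a].
Proof.
move=> ltJ; pose hit i := [set j | `[< meets i j >]]%SET.
(* The rays in [P] stay as they are and the few rays of [S] they meet are given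
   up. By maximality of [P], any other ray meets more than [#|I|] of the
   remaining rays of [S], so it is never rejected by all of them. *)
pose JP (P : {set I}) := (\bigcup_(i in P) hit i)%SET.
pose poor P := #|JP P| <= #|P| * #|I|.
have /ex_maxset[P /maxsetP[Ppoor Pmax]] : exists P, poor P.
  by exists finset.set0; rewrite /poor /JP big_set0 !cards0.
have leP : #|P| * #|I| <= #|I| * #|I| by rewrite leq_mul2r max_card orbT.
pose A := (~: P)%SET; pose B := (~: JP P)%SET.
have cardB : #|B| = #|J| - #|JP P| by rewrite /B cardsCs finset.setCK.
have cardA : #|A| <= #|I| by exact: max_card.
have Bgt : #|A| < #|B| by rewrite /poor in Ppoor; lia.
have [j1 j1B] : exists j, j \in B by apply/card_gt0P; lia.
have [|t [m [a [tP mP minj]]]] := @stable_matching A B j1.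
  move=> i; rewrite inE => iP; rewrite ltnNge; apply/negP => le.
  have : (i |: P = P)%SET.
    apply: Pmax (finset.subsetUr _ _); rewrite /poor /JP finset.bigcup_setU big_set1.
    have -> : (hit i :|: JP P = [set j in B | `[< meets i j >]] :|: JP P)%SET.
      apply/finset.setP => j; rewrite !inE.
      by case: (j \in JP P); rewrite ?orbT ?orbF.
    apply: leq_trans (leq_card_setU _ _) _; rewrite cardsU1 iP mulSn.
    by apply: leq_add => //; exact: leq_trans cardA.
  by move/finset.setP/(_ i); rewrite !inE eqxx (negPf iP).
have [j0 j0B j0m] : exists2 j, j \in B & j \notin [set m i | i in A]%SET.
  have [/fintype.subsetP sub|] := boolP (B \subset [set m i | i in A]%SET).
    have := leq_trans Bgt (subset_leq_card (introT fintype.subsetP sub)).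
    by rewrite ltnNge leq_imset_card.
  by case/fintype.subsetPn => j; exists j.
(* A retained piece of [R] meets a ray of [B] only up to the point where the partner of that ray
   switches to it. Hence the tails taken over are free, and unmatched rays of [B] are not met at
   all. *)
have cross i k j b : (i \notin A) || (k <= t i) -> j \in B -> R i k = S j b ->
    exists i', [/\ i' \in A, m i' = j & b <= a i'].
  move=> kP jB RSb; have [iA|iA] := boolP (i \in A); last first.
    move: jB; rewrite inE => /finset.bigcupP[]; exists i.
      by move: iA; rewrite inE negbK.
    by rewrite inE; apply/asboolP; exists k, b.
  rewrite iA /= leq_eqVlt in kP; case/orP: kP => [/eqP kt|kt].
    have [_ RSi] := mP i iA.
    have [mj ab] : m i = j /\ a i = b by apply: Sinj; rewrite -RSi -kt.
    by exists i; rewrite ab.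
  have [i' [b' [i'A RSb' bb']]] := tP _ _ _ _ iA jB kt RSb.
  have [_ RSi'] := mP i' i'A; have [mj ab] := Sinj (etrans (esym RSi') RSb').
  by exists i'; split=> //; lia.
pose T i := if i \in A then splice (R i) (t i) (S (m i)) (a i) else R i.
have TP i k : ((i \notin A) || (k <= t i) /\ T i k = R i k) \/
    [/\ i \in A, t i < k & T i k = S (m i) (a i + (k - t i))].
  rewrite /T /splice; have [iA|] := boolP (i \in A); last by left.
  by case: (leqP k (t i)) => kt; [left|right].
have TRS i k i' k' : (i \notin A) || (k <= t i) -> i' \in A -> t i' < k' ->
    R i k <> S (m i') (a i' + (k' - t i')).
  move=> iP i'A tk /cross[] //; first by have [] := mP i' i'A.
  move=> x [xA xm]; rewrite (minj _ _ xA i'A xm); lia.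
exists T, j0; split.
- move=> i i' k k'; have [[iP ->]|[iA tk ->]] := TP i k;
    have [[i'P ->]|[i'A tk' ->]] := TP i' k'.
  + exact: Rinj.
  + by move/(TRS _ _ _ _ iP i'A tk').
  + by move/esym/(TRS _ _ _ _ i'P iA tk).
  + move/Sinj => [/minj ii' kk']; have {}ii' := ii' iA i'A.
    by split=> //; subst i'; lia.
- move=> i k k'; have [[iP ->]|[iA tk ->]] := TP i k.
    move=> /cross[] // x [xA xm _]; move/negP: j0m; apply.
    by rewrite -xm imset_f.
  by move/Sinj => [mj _]; move/negP: j0m; apply; rewrite -mj imset_f.
- move=> i; rewrite /T; case: ifP => [iA|_]; last by left.
  by right; exists (t i), (m i), (a i); have [] := mP i iA.
Qed.
End StableRerouting.

(** * Cardinality tools *)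

Lemma card_le_injection (T U : Type) (A : set T) (B : set U) : (A #<= B)%card ->
  exists g : A -> U, (forall x, B (g x)) /\ injective g.
Proof.
rewrite /card_le => /asboolP[f]; exists (fun x => val (f x)); split.
  by move=> x; exact: set_valP.
by move=> x y /val_inj /inj; apply; rewrite in_setE.
Qed.

Lemma card_eq1P (T : Type) (A : set T) : (A #= `I_1)%card <-> exists x, A = [set x].
Proof.
split=> [/eq_cardSP[x Ax]|[x ->]]; last exact: card_set1.
rewrite II0 card_eq0 => /eqP A0; exists x; apply/seteqP; split=> [y Ay|_ -> //].
apply: contrapT => yx; have : (A `\ x) y by [].
by rewrite A0.
Qed.

(** * Walks, and dipaths obtained by trimming them *)

Section Walks.
Variables (V : eqType) (e : rel V).
Implicit Types (A B : set V) (s X : seq V).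

(** Repetitions and inner vertices in [A] or [B] are allowed, so that a walk stays one when [A] and
    [B] grow. *)
Definition walk A B s : Prop :=
  if s is x :: p then [/\ path e x p, A x & B (last x p)] else False.

(** Remove repetitions first. Then, while an inner vertex lies in [A] or [B], cut there, keeping the
    later part in the first case and the earlier part in the second. *)
Lemma walk_trim A B s : walk A B s -> exists x p,
  [/\ path e x p && uniq (x :: p), A x, B (last x p),
      forall y, y \in behead (belast x p) -> ~ (A `|` B) y &
      {subset x :: p <= s}].
Proof.
case: s => [//|x p] [/shortenP[q xq uq qp] Ax Bx].
have {qp} : {subset x :: q <= x :: p}.
  by move=> y; rewrite !inE => /orP[->//|/qp ->]; rewrite orbT.
move: (x :: p) => s.
have [n] := ubnP (size q); elim: n x q xq uq Ax Bx => // n IHn x q xq uq Ax Bx qn qs.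
have [[y yq yAB]|inner] :=
  pselect (exists2 y, y \in behead (belast x q) & (A `|` B) y); last first.
  exists x, q; rewrite xq uq; split=> // y yq yAB.
  by apply: inner; exists y.
case: q => [//|z q] in xq uq Bx qn qs yq *.
(* An inner vertex differs from the last one, so [q2] is nonempty and the earlier part is strictly
   shorter. *)
have [q1 [q2 [eq q2N]]] : exists q1 q2, z :: q = q1 ++ y :: q2 /\ q2 <> [::].
  move: yq uq => /= yq; rewrite -cons_uniq (lastI z q) => /andP[_].
  rewrite rcons_uniq => /andP[lastq _].
  case/splitPr: yq lastq => q1 q2 lastq.
  by exists q1, (rcons q2 (last z q)); rewrite -cats1 -catA /= cats1; case: (q2).
rewrite eq in xq uq Bx qn qs.
have size2 : 0 < size q2 by case: (q2) q2N.
have sub2 : {subset y :: q2 <= x :: (q1 ++ y :: q2)}.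
  by move=> w wq; rewrite inE mem_cat wq !orbT.
case: yAB => [Ay|By].
  apply: (IHn y q2) => //.
  - by move: xq; rewrite cat_path => /andP[_ /andP[]].
  - by move: uq; rewrite -cat_cons cat_uniq => /and3P[].
  - by move: Bx; rewrite last_cat.
  - by move: qn; rewrite size_cat /=; lia.
  - by move=> w /sub2 /qs.
apply: (IHn x (rcons q1 y)) => //.
- by move: xq; rewrite -cat_rcons cat_path => /andP[].
- by move: uq; rewrite -cat_rcons -cat_cons cat_uniq => /and3P[].
- by rewrite last_rcons.
- by move: qn; rewrite size_cat size_rcons /=; lia.
- by move=> w wq; apply: qs; rewrite -cat_rcons -cat_cons mem_cat wq.
Qed.

Definition disjoint_walks A B (W : nat -> seq V) : Prop :=
  (forall n, walk A B (W n)) /\ (forall m n, m < n -> ~~ has (mem (W m)) (W n)).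

(** Finite-avoidance form of having infinitely many disjoint walks: it is insensitive to dropping
    finitely many vertices and lets walks be chosen one at a time. *)
Definition linked A B : Prop :=
  forall X, exists2 s, walk A B s & ~~ has (mem X) s.

(** If every [W n] met [X], picking a common vertex for each [n] would inject the naturals into a
    finite list. *)
Lemma disjoint_walks_linked A B W : disjoint_walks A B W -> linked A B.
Proof.
move=> [walkW disjW] X; apply: contrapT => no.
have /choice[c cP] : forall n, exists y, y \in X /\ y \in W n.
  move=> n; have /hasP[y yW yX] : has (mem X) (W n).
    by apply: contrapT => /negP noX; apply: no; exists (W n).
  by exists y.
have injc : injective c.
  move=> m n; wlog mn : m n / m < n => [wl|cc].
    case: (ltngtP m n) => // mn cc; [|symmetry]; exact: wl.
  have /hasPn/(_ (c n)) := disjW m n mn.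
  by rewrite inE -{2}cc; move/(_ (cP n).2)/negP; case; case: (cP m).
have : size [seq c n | n <- iota 0 (size X).+1] <= size X.
  apply: uniq_leq_size; first by rewrite (map_inj_uniq injc) iota_uniq.
  by move=> _ /mapP[n _ ->]; case: (cP n).
by rewrite size_map size_iota ltnn.
Qed.
End Walks.

Lemma walk_rev (V : eqType) (e : rel V) (A B : set V) (s : seq V) :
  walk e A B s -> walk (fun x y => e y x) B A (rev s).
Proof.
case: s => [//|x p] [xp Ax Bx]; rewrite lastI rev_rcons /=; split=> //.
  by rewrite rev_path.
by case: p {xp Bx} => [|y p] //=; rewrite rev_cons last_rcons.
Qed.

Definition arc_rel (V : eqType) (D : digraph V) : rel V :=
  fun u v => (u, v) \in arcs D.

(** From right to left, the walks are trimmed to dipaths. The hypothesis puts their first vertices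
    into [D], which no arc does for a single-vertex dipath. *)
Lemma end_leP (V : eqType) (D Q R : digraph V) : vset Q `<=` vset D ->
  end_le D Q R <-> exists W, disjoint_walks (arc_rel D) (vset Q) (vset R) W.
Proof.
move=> QD; split=> [[S [SP Sdisj Sinf]]|[W [walkW disjW]]].
  have /infiniteP/card_le_injection[W [WS Winj]] := Sinf.
  exists (fun n => W (SigSub (in_setT n))); split=> [n|m n mn].
    by have [x [p [-> [[_ xp _] Qx Rx _]]]] := SP _ (WS (SigSub (in_setT n))).
  apply/negP => /hasP[y yn ym].
  have /Winj/(congr1 val)/= mn' :=
    Sdisj _ _ (WS _) (WS _) (ex_intro _ y (conj ym yn)).
  by rewrite mn' ltnn in mn.
have /choice[T TP] : forall n, exists t,
    is_dipath_between D (vset Q) (vset R) t /\ {subset t <= W n}.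
  move=> n; have [x [p [/andP[xp up] Qx Rx inner sub]]] := walk_trim (walkW n).
  by exists (x :: p); split=> //; exists x, p; do 3!split=> //; exact: QD.
have Tdisj m n y : y \in T m -> y \in T n -> m = n.
  move=> /(TP m).2 ym /(TP n).2 yn; case: (ltngtP m n) => // /disjW/hasPn.
    by move/(_ y yn); rewrite inE ym.
  by move/(_ y ym); rewrite inE yn.
exists (range T); split.
- by move=> _ [n _ <-]; case: (TP n).
- by move=> _ _ [m _ <-] [n _ <-] [y [ym yn]]; rewrite (Tdisj m n y).
- rewrite (eq_finite_set (inj_card_eq _)); first exact: infinite_nat.
  move=> m n _ _ TT; have [[x [p [Tm _]]] _] := TP m.
  by apply: (Tdisj m n x); rewrite -?TT Tm mem_head.
Qed.

(** * Growing families of disjoint rays linked to a fixed set *)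

Section DisjointRays.
Variables (V : eqType) (e : rel V) (B : set V).
Implicit Types (f g : nat -> V) (r : nat -> nat -> V).

Definition eray f : Prop := forall k, e (f k) (f k.+1).

(** For injective [f], with [B] the vertex set of a representative of an end, this says that the ray
    lies in that end. *)
Definition good f : Prop :=
  [/\ eray f, linked e (range f) B & linked e B (range f)].

(** A walk that also avoids the first [b] vertices of [f] attaches to the common tail, hence to
    [g]. *)
Lemma good_suffix f g a b : eray g -> (forall k, g (a + k) = f (b + k)) ->
  good f -> good g.
Proof.
move=> gray fg [_ fB Bf]; pose X0 := [seq f k | k <- iota 0 b].
have tail k : f k \notin X0 -> range g (f k).
  move=> fk; have [kb|bk] := ltnP k b; last first.
    by exists (a + (k - b)); rewrite // fg subnKC.
  by move/negP: fk; case; apply: map_f; rewrite mem_iota.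
split=> // X.
  have [[//|x p] [xp [k _ fk] Bx]] := fB (X0 ++ X).
  move=> /hasPn avoid; exists (x :: p).
    split=> //; rewrite -fk; apply: tail.
    by have := avoid x (mem_head _ _); rewrite /= mem_cat negb_or fk => /andP[].
  by apply/hasPn => y /avoid; rewrite /= mem_cat negb_or => /andP[].
have [[//|x p] [xp Bx [k _ fk]]] := Bf (X0 ++ X).
move=> /hasPn avoid; exists (x :: p).
  split=> //; rewrite -fk; apply: tail.
  by have := avoid _ (mem_last x p); rewrite /= mem_cat negb_or fk => /andP[].
by apply/hasPn => y /avoid; rewrite /= mem_cat negb_or => /andP[].
Qed.

Lemma good_splice f t g a : eray f -> good g -> f t = g a -> good (splice f t g a).
Proof.
move=> fray ggood fg; have gray : eray g by case: ggood.
have suffix k : splice f t g a (t + k) = g (a + k).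
  rewrite /splice; case: leqP => [tk|_]; last by rewrite addKn.
  have k0 : k = 0 by lia.
  by rewrite k0 !addn0.
apply: (good_suffix _ suffix ggood) => k.
have [kt|tk] := ltnP k t; first by rewrite /splice (ltnW kt) kt; exact: fray.
by rewrite -(subnKC tk) -addnS !suffix addnS; exact: gray.
Qed.

Definition good_family n r : Prop :=
  (forall i, i < n -> good (r i)) /\
  (forall i i' k k', i < n -> i' < n -> r i k = r i' k' -> i = i' /\ k = k').

Hypothesis many_good : forall N : nat, exists S : 'I_N -> nat -> V,
  jointly_injective S /\ forall j, good (S j).

(** Each vertex of [Y] occurs at most once on all the rays together, so a single [K] serves every
    ray. *)
Lemma jointly_injective_avoid (J : Type) (S : J -> nat -> V) (Y : seq V) :
  jointly_injective S -> exists K, forall j k, K <= k -> S j k \notin Y.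
Proof.
move=> Sinj; have /choice[h hP] : forall y, exists K, forall j k, S j k = y -> k < K.
  move=> y; have [[j [k jk]]|no] := pselect (exists j k, S j k = y).
    by exists k.+1 => j' k' jk'; have [_ ->] := Sinj _ _ _ _ (etrans jk' (esym jk)).
  by exists 0 => j k jk; case: no; exists j, k.
exists (\max_(y <- Y) h y) => j k Kk; apply/negP => SY.
have := hP _ j k erefl; rewrite ltnNge => /negP; apply.
by apply: leq_trans Kk; exact: leq_bigmax_seq.
Qed.

(** The fresh rays are first cut back beyond the finitely many protected vertices. Rerouting can
    then switch only at position [l] or later, and the unmatched ray becomes entry [n]. *)
Lemma good_family_augment n r l : good_family n r -> exists r',
  good_family n.+1 r' /\ forall i k, i < n -> k < l -> r' i k = r i k.
Proof.
move=> [rgood rinj]; have [S [Sinj Sgood]] := many_good (n * n + n).+1.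
pose Y := [seq r i k | i <- iota 0 n, k <- iota 0 l].
have [K KP] := jointly_injective_avoid Y Sinj.
pose S' j k := S j (K + k).
have S'inj : jointly_injective S'.
  by move=> j j' k k' /Sinj[-> /addnI ->].
have S'good j : good (S' j).
  apply: (@good_suffix (S j) _ 0 K) => // k.
  by rewrite /S' addnS; case: (Sgood j).
pose R (i : 'I_n) := r i.
have Rinj : jointly_injective R.
  by move=> i i' k k' /rinj[] // /val_inj.
have [|T [j0 [Tinj TS TP]]] := reroute Rinj S'inj; first by rewrite !card_ord.
pose r' i := if insub i is Some u then T u else S' j0.
have r'lt i (ni : i < n) : r' i = T (Ordinal ni) by rewrite /r' insubT.
have r'n : r' n = S' j0 by rewrite /r' insubF ?ltnn.
exists r'; split; last first.
  move=> i k ni kl; rewrite (r'lt i ni).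
  have [->//|[t [j [a [RS ->]]]]] := TP (Ordinal ni).
  have lt : l <= t.
    rewrite leqNgt; apply/negP => tl; have := KP j (K + a) (leq_addr _ _).
    rewrite -/(S' j a) -RS /R /= => /negP; apply.
    by apply/allpairsP; exists (i, t); rewrite !mem_iota.
  by rewrite /splice ifT //; lia.
split=> [i|i i' k k'].
  rewrite ltnS leq_eqVlt => /orP[/eqP ->|ni]; first by rewrite r'n.
  rewrite (r'lt i ni); have [->|[t [j [a [RS ->]]]]] := TP (Ordinal ni).
    exact: rgood.
  by apply: good_splice => //; case: (rgood i ni).
have split_lt m : m < n.+1 -> m = n \/ m < n by lia.
move=> /split_lt[->|ni] /split_lt[->|ni'].
- by rewrite r'n => /S'inj[].
- by rewrite r'n (r'lt _ ni') => /esym/TS.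
- by rewrite r'n (r'lt _ ni) => /TS.
- by rewrite (r'lt _ ni) (r'lt _ ni') => /Tinj[[]].
Qed.

Lemma walk_sub A A' B1 B1' s : A `<=` A' -> B1 `<=` B1' ->
  walk e A B1 s -> walk e A' B1' s.
Proof. by move=> AA BB; case: s => [//|x p] [xp /AA ? /BB ?]. Qed.

Lemma image_initial_sub f l l' : l <= l' -> f @` `I_l `<=` f @` `I_l'.
Proof. by move=> ll _ [k kl <-]; exists k => //=; apply: leq_trans ll. Qed.

(* The entries of [r] at positions below [l] are final; [X] collects the vertices
   of the linking walks chosen so far, which later walks have to avoid. *)
Definition extends n (r : nat -> nat -> V) (l : nat) (X : seq V) r' l' (X' : seq V) :
    Prop :=
  [/\ l < l', {subset X <= X'},
      forall i k, i < n -> k < l' -> r' i k = r i k,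
      forall i, i < n -> exists s,
        [/\ walk e (r i @` `I_l') B s, ~~ has (mem X) s & {subset s <= X'}] &
      forall i, i < n -> exists s,
        [/\ walk e B (r i @` `I_l') s, ~~ has (mem X) s & {subset s <= X'}]].

(** Goodness gives walks avoiding [X] to and from each of the [n] rays. Their ends on the rays are
    protected before augmenting, so they remain on the new rays. *)
Lemma good_family_extend n r l X : good_family n r ->
  exists r' l' X', good_family n.+1 r' /\ extends n r l X r' l' X'.
Proof.
move=> rP; have [rgood _] := rP.
have /choice[w wP] : forall i, exists w : seq V * nat, i < n ->
    walk e (r i @` `I_w.2) B w.1 /\ ~~ has (mem X) w.1.
  move=> i; have [ni|_] := ltnP i n; last by exists ([::], 0).
  have [_ /(_ X)[[//|x p] [xp [k _ rk] Bx] avoid] _] := rgood i ni.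
  by exists (x :: p, k.+1) => _; do 2!split=> //; exists k => /=.
have /choice[v vP] : forall i, exists v : seq V * nat, i < n ->
    walk e B (r i @` `I_v.2) v.1 /\ ~~ has (mem X) v.1.
  move=> i; have [ni|_] := ltnP i n; last by exists ([::], 0).
  have [_ _ /(_ X)[[//|x p] [xp Bx [k _ rk]] avoid]] := rgood i ni.
  by exists (x :: p, k.+1) => _; do 2!split=> //; exists k => /=.
pose l' := (l + \sum_(i < n) ((w i).2 + (v i).2)).+1.
have ltl' i : i < n -> (w i).2 + (v i).2 <= l'.
  by move=> ni; rewrite /l' (bigD1 (Ordinal ni)) //=; lia.
have [r' [r'P r'r]] := good_family_augment l' rP.
pose X' := X ++ flatten [seq (w i).1 ++ (v i).1 | i <- iota 0 n].
have subX' i y : i < n -> y \in (w i).1 ++ (v i).1 -> y \in X'.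
  move=> ni yi; rewrite mem_cat; apply/orP; right; apply/flattenP.
  by exists ((w i).1 ++ (v i).1) => //; apply/mapP; exists i; rewrite ?mem_iota.
exists r', l', X'; split=> //; split=> //.
- by rewrite /l'; lia.
- by move=> y yX; rewrite mem_cat yX.
- move=> i ni; have [wi avoid] := wP i ni; exists (w i).1; split=> //.
    by apply: walk_sub wi => //; apply: image_initial_sub; have := ltl' i ni; lia.
  by move=> y yi; apply: subX' ni _; rewrite mem_cat yi.
- move=> i ni; have [vi avoid] := vP i ni; exists (v i).1; split=> //.
    by apply: walk_sub vi => //; apply: image_initial_sub; have := ltl' i ni; lia.
  by move=> y yi; apply: subX' ni _; rewrite mem_cat yi orbT.
Qed.

(** Each ray is final on ever longer initial segments, so a limit exists; its disjointness concerns
    two positions at a time and is seen at a finite stage. *)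
Lemma infinitely_many_good : exists f : nat -> nat -> V,
  [/\ jointly_injective f, forall i, eray (f i),
      forall i, exists W, disjoint_walks e (range (f i)) B W &
      forall i, exists W, disjoint_walks e B (range (f i)) W].
Proof.
have [S0 _] := many_good 1.
pose state : Type := (nat -> nat -> V) * nat * seq V.
have /choice[F FP] : forall ns : nat * state, exists s' : state,
    good_family ns.1 ns.2.1.1 -> good_family ns.1.+1 s'.1.1 /\
      extends ns.1 ns.2.1.1 ns.2.1.2 ns.2.2 s'.1.1 s'.1.2 s'.2.
  move=> [n [[r l] X]] /=.
  have [/(good_family_extend l X)[r' [l' [X' ext]]]|no] := pselect (good_family n r).
    by exists (r', l', X').
  by exists ((r, l), X).
(* Stage [0] holds no rays, so [S0 ord0] is only a filler. *)
pose st := fix st n : state :=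
  if n is m.+1 then F (m, st m) else (fun=> S0 ord0, 0, [::]).
pose r n := (st n).1.1; pose l n := (st n).1.2; pose X n := (st n).2.
have rP n : good_family n (r n).
  by elim: n => [|n IHn]; [split | case: (FP (n, st n) IHn)].
have ext n : extends n (r n) (l n) (X n) (r n.+1) (l n.+1) (X n.+1).
  by case: (FP (n, st n) (rP n)).
have lS n : l n < l n.+1 by case: (ext n).
have lmono m n : m <= n -> l m <= l n.
  move=> /subnKC <-; elim: (n - m) => [|d IH]; rewrite ?addn0 // addnS.
  by have := lS (m + d); lia.
have l_ge n : n <= l n by elim: n => // n IHn; have := lS n; lia.
have Xmono m n : m <= n -> {subset X m <= X n}.
  move=> /subnKC <-; elim: (n - m) => [|d IH]; rewrite ?addn0 // addnS.
  by move=> y /IH; case: (ext (m + d)) => _ sub _ _ _ /sub.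
have stable i m n k : i < m -> m <= n -> k < l m.+1 -> r n i k = r m i k.
  move=> im /subnKC <- kl; elim: (n - m) => [|d IH]; rewrite ?addn0 // addnS.
  have [_ _ -> //] := ext (m + d); first by lia.
  by apply: leq_trans kl _; apply: lmono; lia.
(* Ray [i] is present from stage [i.+1] on, and at stage [(i + k).+1] its position [k] is final
   because [n <= l n]. *)
pose f i k := r (i + k).+1 i k.
have fE i m k : i < m -> k < l m.+1 -> r m i k = f i k.
  move=> im kl; rewrite /f -(stable i m (m + (i + k).+1)) //; last by lia.
  by apply: stable; [lia | lia | have := l_ge (i + k).+2; lia].
have fE' i m k : i + k < m -> r m i k = f i k.
  by move=> ikm; apply: fE; [lia | have := l_ge m.+1; lia].
have fwalk i m : i < m -> r m i @` `I_(l m.+1) `<=` range (f i).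
  by move=> im _ [k kl <-]; exists k => //; rewrite fE.
(* Each walk avoids the vertices collected before its stage and is itself collected there, so walks
   of different stages are disjoint. *)
have disj (W : nat -> seq V) i : (forall n, ~~ has (mem (X (i + n))) (W n)) ->
    (forall n, {subset W n <= X (i + n).+1}) ->
    forall m n, m < n -> ~~ has (mem (W m)) (W n).
  move=> avoid sub m n mn; apply/hasPn => y yn; apply/negP => ym.
  have /hasPn/(_ y yn)/negP := avoid n; apply.
  by apply: (Xmono (i + m).+1); [lia | exact: sub].
exists f; split.
- move=> i i' k k'; pose m := (i + k + i' + k').+1.
  rewrite -(fE' i m) /m; last by lia.
  rewrite -(fE' i' m) /m; last by lia.
  by case: (rP m) => _; apply; rewrite /m; lia.
- move=> i k; rewrite -(fE' i (i + k).+2 k) ?(fE' i (i + k).+2 k.+1); [|lia..].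
  rewrite -(fE' i (i + k).+2 k.+1); last by lia.
  by case: (rP (i + k).+2) => /(_ i) [] //; lia.
(* Stages are counted from [i.+1], the first at which ray [i] is present. *)
- move=> i; have /choice[W WP] : forall n, exists s,
    [/\ walk e (r (i.+1 + n) i @` `I_(l (i.+1 + n).+1)) B s,
        ~~ has (mem (X (i.+1 + n))) s & {subset s <= X (i.+1 + n).+1}].
    by move=> n; have [_ _ _ + _] := ext (i.+1 + n); apply; lia.
  exists W; split=> [n|]; last by apply: (disj W i.+1) => n; case: (WP n).
  by have [+ _ _] := WP n; apply: walk_sub => //; apply: fwalk; lia.
- move=> i; have /choice[W WP] : forall n, exists s,
    [/\ walk e B (r (i.+1 + n) i @` `I_(l (i.+1 + n).+1)) s,
        ~~ has (mem (X (i.+1 + n))) s & {subset s <= X (i.+1 + n).+1}].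
    by move=> n; have [_ _ _ _] := ext (i.+1 + n); apply; lia.
  exists W; split=> [n|]; last by apply: (disj W i.+1) => n; case: (WP n).
  by have [+ _ _] := WP n; apply: walk_sub => //; apply: fwalk; lia.
Qed.
End DisjointRays.

(** * Rays as digraphs and as injective sequences *)

Lemma is_ray_enum (V : Type) (H : digraph V) : is_ray H -> exists f,
  [/\ injective f, vset H = range f & forall k, arcs H (f k, f k.+1)].
Proof.
move=> [conn [r Hr [in0 out1 inout1]]].
have noin u : ~ arcs H (u, r).
  move: in0; rewrite /indegree_is II0 card_eq0 => /eqP in0 ur.
  by rewrite -[False]/(set0 u) -in0.
have uniqin u u' v : arcs H (u, v) -> arcs H (u', v) -> u = u'.
  move=> uv u'v; have vr : v <> r by move=> vr; rewrite vr in uv; exact: noin uv.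
  have [/card_eq1P[x xP] _] := inout1 v (arcs_ends uv).2 vr.
  have -> : u = x by rewrite -[_ = _]/([set x] u) -xP.
  by symmetry; rewrite -[_ = _]/([set x] u') -xP.
have /choice[next nextP] : forall v, exists w, vset H v ->
    arcs H (v, w) /\ forall w', arcs H (v, w') -> w' = w.
  move=> v; have [Hv|] := pselect (vset H v); last by exists r.
  have /card_eq1P[w wP] : outdegree_is H v 1.
    by have [->//|vr] := pselect (v = r); case: (inout1 v Hv vr).
  exists w => _; split; first by rewrite -[arcs _ _]/([set w | arcs H (v, w)] w) wP.
  by move=> w' vw'; rewrite -[_ = _]/([set w] w') -wP.
pose f k := iter k next r.
have Hf k : vset H (f k).
  by elim: k => //= k /nextP[kv _]; case: (arcs_ends kv).
have farc k : arcs H (f k, f k.+1) by case: (nextP _ (Hf k)).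
(* Equal vertices trace back along unique in-arcs to the start, which has none. *)
have finj : injective f.
  elim=> [|k IHk] [|k'] // fk.
  - by have := farc k'; rewrite -fk => /noin.
  - by have := farc k; rewrite fk => /noin.
  - by congr _.+1; apply: IHk; apply: (uniqin _ _ (f k.+1)) => //; rewrite fk.
exists f; split=> //; apply/seteqP; split=> [v Hv|_ [k _ <-] //].
(* The range is closed under arcs in both directions, so weak connectivity makes it all of [H]. *)
have closed x y : clos_refl_sym_trans V (fun x y => arcs H (x, y)) x y ->
    range f x <-> range f y.
  elim=> {x y} [x y xy| | |]; [|by []|by move=> x y _ []; split|].
    split=> [[k _ fx]|[[|k] _ fy]].
    - exists k.+1 => //; have [_ nextE] := nextP _ (Hf k).
      by apply/esym/nextE; rewrite fx.
    - by rewrite -fy in xy; case: (noin x).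
    - by exists k => //; apply: uniqin (farc k) _; rewrite fy.
  by move=> x y z _ [xy yx] _ [yz zy]; split=> [/xy/yz|/zy/yx].
by apply/(closed _ _ (conn _ _ Hr Hv)); exists 0.
Qed.

Lemma ray_arcs_ends (V : Type) (f : nat -> V) u v :
  [set uv | exists k, uv = (f k, f k.+1)] (u, v) -> range f u /\ range f v.
Proof. by move=> [k [-> ->]]; split; [exists k | exists k.+1]. Qed.

Definition ray_digraph (V : Type) (f : nat -> V) : digraph V :=
  Digraph (@ray_arcs_ends V f).

Lemma ray_digraph_is_ray (V : Type) (f : nat -> V) :
  injective f -> is_ray (ray_digraph f).
Proof.
move=> finj.
have out1 k : outdegree_is (ray_digraph f) (f k) 1.
  apply/card_eq1P; exists (f k.+1); apply/seteqP; split=> [w|_ ->]; last by exists k.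
  by move=> [k' [/finj <- ->]].
split.
  have conn k :
      clos_refl_sym_trans V (fun x y => arcs (ray_digraph f) (x, y)) (f 0) (f k).
    elim: k => [|k IHk]; first exact: rst_refl.
    by apply: rst_trans IHk _; apply: rst_step; exists k.
  move=> _ _ [k _ <-] [k' _ <-].
  by apply: rst_trans (conn k'); apply: rst_sym.
exists (f 0); first by exists 0.
split=> //.
  rewrite /indegree_is II0 card_eq0; apply/eqP/seteqP; split=> // u [k [_ /finj //]].
move=> _ [[|k] _ <-] // _; split=> //.
apply/card_eq1P; exists (f k); apply/seteqP; split=> [u|_ ->]; last by exists k.
by move=> [k' [-> /finj [->]]].
Qed.

(** Being in the end means being joined to the representative [R0] both ways, so goodness relative
    to [vset R0] is the condition carried through the construction. *)
Lemma infinitely_many_disjoint_rays (V : eqType) (D : digraph V)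
    (w : set (digraph V)) :
  is_end D w ->
  (forall n : nat, has_n_disjoint (w `&` [set R | is_ray R]) n) ->
  has_infinitely_many_disjoint (w `&` [set R | is_ray R]).
Proof.
move=> [R0 [[R0D _] _] ->] many.
have many_good N : exists S : 'I_N -> nat -> V,
    jointly_injective S /\ forall j, good (arc_rel D) (vset R0) (S j).
  have [S [SP Sdisj]] := many N.
  rewrite card_eq_le => /andP[_ /card_le_injection[g [gS ginj]]].
  pose sub (i : 'I_N) : `I_N := SigSub (@mem_set _ `I_N _ (ltn_ord i)).
  pose H i := g (sub i).
  have Hinj i i' : H i = H i' -> i = i'.
    by move=> /ginj/(congr1 val)/= ii'; exact: val_inj.
  have /choice[f fP] : forall i, exists f,
      [/\ injective f, vset (H i) = range f & forall k, arcs (H i) (f k, f k.+1)].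
    by move=> i; apply: is_ray_enum; case: (SP _ (gS (sub i))).
  exists f; split=> [i i' k k' fk|i].
    have ii' : i = i'.
      apply/Hinj/Sdisj; [exact: gS | exact: gS |]; exists (f i k); split.
        by have [_ -> _] := fP i; exists k.
      by have [_ -> _] := fP i'; rewrite fk; exists k'.
    by split=> //; rewrite -ii' in fk; case: (fP i) => + _ _; apply.
  have [[[[HD arcHD] _] [le ge]] _] := SP _ (gS (sub i)).
  have [_ rangef arcf] := fP i.
  split; first by move=> k; apply/mem_set/arcHD/arcf.
    by rewrite -rangef; have /end_leP[//|W /disjoint_walks_linked] := le.
  by rewrite -rangef; have /end_leP[//|W /disjoint_walks_linked] := ge.
have [f [finj fray fR Rf]] := infinitely_many_good many_good.
have frayD i : subdigraph (ray_digraph (f i)) D.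
  split=> [_ [k _ <-]|_ [k ->]]; last by rewrite -in_setE; exact: fray.
  by have /set_mem fk := fray i k; case: (arcs_ends fk).
exists (range (fun i => ray_digraph (f i))); split.
- move=> _ [i _ <-]; have isray : is_ray (ray_digraph (f i)).
    by apply: ray_digraph_is_ray => k k' /finj[].
  split=> //; split; first by split; [exact: frayD | left].
  by split; apply/end_leP => //; [case: (frayD i) | exact: fR | exact: Rf].
- by move=> _ _ [i _ <-] [i' _ <-] [_ [[k _ <-] [k' _ /finj[->]]]].
- rewrite (eq_finite_set (inj_card_eq _)); first exact: infinite_nat.
  move=> i i' _ _ /(congr1 (@vset V))/= ff.
  have : range (f i') (f i 0) by rewrite -ff; exists 0.
  by case=> k _ /finj[].
Qed.

(** * Reversal of arcs *)

Lemma rev_arcs_ends (V : Type) (D : digraph V) u v :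
  [set uv | arcs D (uv.2, uv.1)] (u, v) -> vset D u /\ vset D v.
Proof. by move=> vu; case: (arcs_ends vu). Qed.

Definition rev_digraph (V : Type) (D : digraph V) : digraph V :=
  Digraph (@rev_arcs_ends V D).

(** Proof irrelevance for [arcs_ends] yields genuine equality, so that reversal is an involution and
    acts on sets of digraphs. *)
Lemma digraph_eq (V : Type) (D D' : digraph V) :
  vset D = vset D' -> arcs D = arcs D' -> D = D'.
Proof.
case: D => vs ar ends; case: D' => vs' ar' ends' /= vv aa.
by subst vs' ar'; congr Digraph; exact: Prop_irrelevance.
Qed.

Lemma rev_digraphK (V : Type) : involutive (@rev_digraph V).
Proof. by move=> D; apply: digraph_eq => //; apply/seteqP; split=> [[]|[]]. Qed.

Lemma weakly_connected_rev (V : Type) (H : digraph V) :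
  weakly_connected H -> weakly_connected (rev_digraph H).
Proof.
move=> conn u v Hu Hv; elim: (conn u v Hu Hv) => {u v Hu Hv}.
- by move=> x y xy; apply: rst_sym; apply: rst_step.
- by move=> x; exact: rst_refl.
- by move=> x y _ xy; exact: rst_sym.
- by move=> x y z _ xy _ yz; exact: rst_trans xy yz.
Qed.

Lemma is_ray_rev (V : Type) (H : digraph V) :
  is_ray H -> is_antiray (rev_digraph H).
Proof.
move=> [/weakly_connected_rev conn [r Hr [in0 out1 inout1]]].
by split=> //; exists r => //; split=> // v Hv /(inout1 v Hv)[].
Qed.

Lemma is_antiray_rev (V : Type) (H : digraph V) :
  is_antiray H -> is_ray (rev_digraph H).
Proof.
move=> [/weakly_connected_rev conn [r Hr [in1 out0 inout1]]].
by split=> //; exists r => //; split=> // v Hv /(inout1 v Hv)[].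
Qed.

Lemma rays_and_antirays_rev (V : Type) (D Q : digraph V) :
  rays_and_antirays D Q -> rays_and_antirays (rev_digraph D) (rev_digraph Q).
Proof.
move=> [[QD arcQD] ray]; split; first by split=> // -[u v] /arcQD.
by case: ray => [/is_ray_rev|/is_antiray_rev]; [right | left].
Qed.

Lemma end_le_rev (V : eqType) (D Q R : digraph V) :
  vset Q `<=` vset D -> vset R `<=` vset D ->
  end_le D Q R -> end_le (rev_digraph D) (rev_digraph R) (rev_digraph Q).
Proof.
move=> QD RD /end_leP[//|W [walkW disjW]]; apply/end_leP => //.
exists (fun n => rev (W n)); split=> [n|m n mn].
  have := walk_rev (walkW n); set e := (X in walk X _ _ _).
  by have -> : e = arc_rel (rev_digraph D) by apply/funext => u; apply/funext.
by rewrite has_rev (eq_has (mem_rev _)) disjW.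
Qed.

Lemma end_equiv_rev (V : eqType) (D Q R : digraph V) :
  vset Q `<=` vset D -> vset R `<=` vset D ->
  end_equiv D Q R -> end_equiv (rev_digraph D) (rev_digraph Q) (rev_digraph R).
Proof. by move=> QD RD [QR RQ]; split; exact: end_le_rev. Qed.

Lemma is_end_rev (V : eqType) (D : digraph V) (w : set (digraph V)) :
  is_end D w -> is_end (rev_digraph D) (@rev_digraph V @^-1` w).
Proof.
move=> [R RD ->]; exists (rev_digraph R); first exact: rays_and_antirays_rev.
have [[RDs _] _] := RD.
apply/seteqP; split=> Q [QD QR].
  have [[QDs _] _] := QD; rewrite -[Q]rev_digraphK.
  by split; [exact: rays_and_antirays_rev | exact: end_equiv_rev].
have [[QDs _] _] := QD; split.
  by rewrite -[D]rev_digraphK; exact: rays_and_antirays_rev.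
by rewrite -[D]rev_digraphK -[R]rev_digraphK; exact: end_equiv_rev.
Qed.

Lemma rev_family (V : Type) (S : set (digraph V)) :
  trivIset S (@vset V) -> trivIset (@rev_digraph V @^-1` S) (@vset V).
Proof.
by move=> Sdisj Q Q' SQ SQ' QQ'; apply: (can_inj (@rev_digraphK V)); exact: Sdisj.
Qed.

Lemma card_rev_family (V : Type) (S : set (digraph V)) :
  (@rev_digraph V @^-1` S #= S)%card.
Proof.
have -> : @rev_digraph V @^-1` S = @rev_digraph V @` S.
  apply/seteqP; split=> [Q SQ|_ [Q SQ <-]]; last by rewrite /= rev_digraphK.
  by exists (rev_digraph Q); rewrite ?rev_digraphK.
by apply: inj_card_eq => Q Q' _ _; exact: can_inj (@rev_digraphK V) _ _.
Qed.

Theorem theorem3p1 (V : eqType) (D : digraph V) :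
  (forall w : set (digraph V), is_end D w ->
     (forall n : nat, has_n_disjoint (w `&` [set R | is_ray R]) n) ->
     has_infinitely_many_disjoint (w `&` [set R | is_ray R])) /\
  (forall w : set (digraph V), is_end D w ->
     (forall n : nat, has_n_disjoint (w `&` [set R | is_antiray R]) n) ->
     has_infinitely_many_disjoint (w `&` [set R | is_antiray R])).
Proof.
split=> [|w endw many]; first exact: infinitely_many_disjoint_rays.
(* Reversal turns the anti-rays of the end into rays of an end of the reversed digraph, preserving
   disjointness and cardinality. *)
have [|S [SP Sdisj Sinf]] := infinitely_many_disjoint_rays (is_end_rev endw).
  move=> n; have [S [SP Sdisj Sn]] := many n.
  exists (@rev_digraph V @^-1` S); split; [|exact: rev_family|].
    by move=> Q /SP[wQ /is_antiray_rev]; rewrite rev_digraphK.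
  exact: card_eq_trans (card_rev_family S) Sn.
exists (@rev_digraph V @^-1` S); split; [|exact: rev_family|].
  by move=> Q /SP[]; rewrite /= rev_digraphK => wQ /is_ray_rev; rewrite rev_digraphK.
by rewrite (eq_finite_set (card_rev_family S)).
Qed.
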